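(* Let $T$ and $T'$ be par-operator gen-semigroups, let $\theta\subseteq T\times T'$, and let $\phi$ be a $\theta$-morphism from a $T$-space $S$ to a $T'$-space $S'$. Let $Q_\phi=\{\phi^{-1}(z):z\in\operatorname{Im}\phi\}$, let $T_\phi^{\#}$ be the induced par-operator gen-semigroup on $Q_\phi$, let $\phi^*:Q_\phi\to\operatorname{Im}\phi$ be given by $\phi^{-1}(z)\mapsto z$, and let $\theta^*=\{(f_\phi^*,g):(f,g)\in\theta\}$. Suppose that $\operatorname{Im}\phi$ is a $T'$-space. Then $\phi^*$ is a $\theta^*$-isomorphism from the $T_\phi^{\#}$-space $Q_\phi$ to the $T'$-space $\operatorname{Im}\phi$.
   Context: A partial function $f$ of $n$ variables from $D^n$ to $D$ is a function from a (possibly empty) subset of $D^n$ (its domain of definition) to $D$; $f(x_1,\dots,x_m)$ is well-defined if $(x_1,\dots,x_m)$ lies in the domain of definition. For an $n$-variable $f$ and partial functions $g_i$ of $n_i$ variables, the composite $f\circ(g_1,\dots,g_n)$ is the partial function of $n_1+\cdots+n_n$ variables obtained by substituting $g_1,\dots,g_n$, evaluated on consecutive disjoint blocks of variables, into $f$ (defined where all involved values are defined). A par-operator gen-semigroup on a set $D$ is a set $T$ of partial functions $D^n\to D$ ($n\in\mathbb{Z}^+$ arbitrary) such that for every $n\in\mathbb{Z}^+$, $n$-variable $f\in T$ and $g_1,\dots,g_n\in T$, the composite $f\circ(g_1,\dots,g_n)$ is a restriction of some element of $T$. For a par-operator gen-semigroup $T$ on $D$ and $U\subseteq D$, $\langle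 U\rangle_T$ is the set of all well-defined values $f(u_1,\dots,u_n)$ with $f\in T$, $(u_1,\dots,u_n)\in U^n$, $n\in\mathbb{Z}^+$; such sets are the $T$-spaces. Let $T_1,T_2$ be par-operator gen-semigroups on $D_1,D_2$ and $\theta\subseteq T_1\times T_2$. For $A\subseteq D_2$, $\theta|_A=\{(f,g|_A):(f,g)\in\theta\}$, where $g|_A$ is obtained by restricting every variable of $g$ to $A$. For $f\in\operatorname{Dom}\theta$, $\theta(f)(b_1,\dots,b_n)$ is well-defined if for all $g$ with $(f,g)\in\theta$ the value $g(b_1,\dots,b_n)$ is well-defined and is the same; $\theta(f)(b_1,\dots,b_n)$ denotes that value. A map $\phi$ from a $T_1$-space $S$ to a $T_2$-space is a $\theta$-morphism if (i) $\theta|_{\operatorname{Im}\phi}$ is a map, and (ii) for all $n\in\mathbb{Z}^+$, $(a_1,\dots,a_n)\in S^n$ and $f\in\operatorname{Dom}\theta$, either neither $f(a_1,\dots,a_n)$ nor $\theta(f)(\phi(a_1),\dots,\phi(a_n))$ is well-defined, or both are well-defined and $\phi(f(a_1,\dots,a_n))=\theta(f)(\phi(a_1),\dots,\phi(a_n))$. A $\theta$-isomorphism is a bijective $\theta$-morphism. For an $n$-variable $f\in T$, $f_\phi^*$ denotes the relation consisting of all tuples $(\phi^{-1}(\phi(x_1)),\dots,\phi^{-1}(\phi(x_n)),\phi^{-1}(\phi(f(x_1,\dots,x_n))))$ with $(x_1,\dots,x_n)\in S^n$ and $f(x_1,\dots,x_n)$ well-defined; it is regarded (as the paper asserts) as the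 partial function $Q_\phi^n\to Q_\phi$ given by $$(\phi^{-1}(\phi(x_1)),\dots,\phi^{-1}(\phi(x_n)))\mapsto\phi^{-1}(\phi(f(x_1,\dots,x_n))).$$ Put $T_\phi^*=\{f_\phi^*:f\in T\}$ and $T_\phi^{\#}=\{\operatorname{Id}_{Q_\phi}\}\cup T_\phi^*$. The paper asserts that $T_\phi^{\#}$ is a par-operator gen-semigroup on $Q_\phi$ and that $Q_\phi=\langle Q_\phi\rangle_{T_\phi^{\#}}$, so that $Q_\phi$ is a $T_\phi^{\#}$-space. *)

(* Defs.v *)
From Stdlib Require List.
From HB Require Import structures.
From mathcomp Require Import all_boot.
From mathcomp Require Import boolp classical_sets functions.

Set Implicit Arguments.
Unset Strict Implicit.
Unset Printing Implicit Defensive.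

Local Open Scope classical_set_scope.

(* A partial function is its graph: [f (xs, y)] reads "f(xs) is well-defined
   and equal to y".  The number of variables is not part of the data, so the
   nowhere defined function is a partial function of n variables for every n;
   this is the set-theoretic notion of a function on a subset of D^n. *)
Definition graph (X : Type) : Type := set (seq X * X).

(* Base sets are subsets D of an ambient type, so that they may be empty and
   so that the fibres of a map, which live in [set X], can form a base set. *)
Definition partial_fun (X : Type) (D : set X) (n : nat) (f : graph X) : Prop :=
  (forall xs y, f (xs, y) -> [/\ size xs = n, List.Forall D xs & D y]) /\
  (forall xs y y', f (xs, y) -> f (xs, y') -> y = y').

Definition operator (X : Type) (D : set X) (f : graph X) : Prop :=
  exists2 n, 0 < n & partial_fun D n f.

Definition composite (X : Type) (n : nat) (f : graph X) (g : 'I_n -> graph X) :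
    graph X :=
  [set p | exists (xss : 'I_n -> seq X) (ys : 'I_n -> X),
     [/\ forall i, g i (xss i, ys i),
         f ([seq ys i | i : 'I_n], p.2) &
         p.1 = flatten [seq xss i | i : 'I_n]]].

(* Inclusion of graphs is "being a restriction of". *)
Definition par_operator_gen_semigroup (X : Type) (D : set X)
    (T : set (graph X)) : Prop :=
  (forall f, T f -> operator D f) /\
  (forall n f (g : 'I_n -> graph X), 0 < n -> T f -> partial_fun D n f ->
     (forall i, T (g i)) -> exists2 h, T h & composite f g `<=` h).

Definition generated (X : Type) (T : set (graph X)) (U : set X) : set X :=
  [set y | exists f xs, [/\ T f, 0 < size xs, List.Forall U xs & f (xs, y)]].

Definition is_space (X : Type) (D : set X) (T : set (graph X)) (S : set X) :
    Prop :=
  exists2 U, U `<=` D & S = generated T U.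

Definition restrict_vars (X : Type) (A : set X) (g : graph X) : graph X :=
  [set p | g p /\ List.Forall A p.1].

Section Morphisms.
Variables (X1 X2 : Type).
Implicit Types (theta : set (graph X1 * graph X2)) (f : graph X1).

Definition dom_theta theta : set (graph X1) :=
  [set f | exists g, theta (f, g)].

Definition theta_restr theta (A : set X2) : set (graph X1 * graph X2) :=
  [set (p.1, restrict_vars A p.2) | p in theta].

Definition is_map theta : Prop :=
  forall f g g', theta (f, g) -> theta (f, g') -> g = g'.

(* The graph of theta(f); empty if f is not in the domain of theta. *)
Definition theta_app theta f : graph X2 :=
  [set p | dom_theta theta f /\ forall g, theta (f, g) -> g p].

(* theta is a subset of T1 x T2.  The conditions [operator D1 f] and
   [operator D2 g] are automatic when T1 and T2 are par-operator
   gen-semigroups; they are spelled out because theta is also used below with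
   sets of graphs T1 that need not be par-operator gen-semigroups. *)
Definition operator_relation (D1 : set X1) (T1 : set (graph X1))
    (D2 : set X2) (T2 : set (graph X2)) theta : Prop :=
  forall f g, theta (f, g) ->
    [/\ T1 f, T2 g, operator D1 f & operator D2 g].

(* A map defined on S is a function on the ambient type of which only the
   values on S matter. *)
Definition theta_morphism (D1 : set X1) (T1 : set (graph X1))
    (D2 : set X2) (T2 : set (graph X2)) theta
    (S : set X1) (S' : set X2) (phi : X1 -> X2) : Prop :=
  [/\ operator_relation D1 T1 D2 T2 theta,
      is_space D1 T1 S /\ is_space D2 T2 S',
      set_fun S S' phi,
      is_map (theta_restr theta (phi @` S)) &
      forall xs f, 0 < size xs -> List.Forall S xs -> dom_theta theta f ->
        (~ (exists y, f (xs, y)) /\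
         ~ (exists z, theta_app theta f (map phi xs, z))) \/
        (exists y z, [/\ f (xs, y), theta_app theta f (map phi xs, z) &
                         phi y = z])].

Definition theta_isomorphism (D1 : set X1) (T1 : set (graph X1))
    (D2 : set X2) (T2 : set (graph X2)) theta
    (S : set X1) (S' : set X2) (phi : X1 -> X2) : Prop :=
  theta_morphism D1 T1 D2 T2 theta S S' phi /\ set_bij S S' phi.

End Morphisms.

Section Quotient.
Variables (X : Type) (X' : pointedType) (S : set X) (phi : X -> X').

Definition fibre (z : X') : set X := S `&` phi @^-1` [set z].

Definition quotient : set (set X) := [set fibre z | z in phi @` S].

(* f^*_phi as a relation.  It need not be single-valued when f is not in the
   domain of theta; it is when f is in the domain of theta and phi is a
   theta-morphism. *)
Definition graph_star (f : graph X) : graph (set X) :=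
  [set p | exists xs y, [/\ List.Forall S xs, f (xs, y) &
     p = ([seq fibre (phi x) | x <- xs], fibre (phi y))]].

Definition id_graph (Y : Type) (Q : set Y) : graph Y :=
  [set ([:: q], q) | q in Q].

Definition T_star (T : set (graph X)) : set (graph (set X)) := graph_star @` T.

Definition T_sharp (T : set (graph X)) : set (graph (set X)) :=
  [set id_graph quotient] `|` T_star T.

Definition theta_star (theta : set (graph X * graph X')) :
    set (graph (set X) * graph X') :=
  [set (graph_star p.1, p.2) | p in theta].

(* [get] picks the unique z in the image of phi whose fibre is q; outside the
   quotient the value is irrelevant. *)
Definition phi_star (q : set X) : X' :=
  get [set z | (phi @` S) z /\ fibre z = q].

End Quotient.

(* Main.v *)
Require Import Defs.
From mathcomp Require Import all_boot.
From mathcomp Require Import boolp classical_sets functions.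

Set Implicit Arguments.
Unset Strict Implicit.
Unset Printing Implicit Defensive.

Local Open Scope classical_set_scope.

(** Write [I] for the image of [phi].  Since the nonempty fibres of [phi]
determine the points over which they lie, [z |-> fibre z] is a bijection from
[I] onto the quotient, and [phi_star] is its inverse.

The theorem says that this bijection carries operators to operators, and that
is what [graph_star_fibre] shows: if [theta] relates [f] to [g], then on
arguments from [I] the graph of [g] is exactly the graph of [f*] read through
[z |-> fibre z].  One direction is the morphism property at arbitrary
representatives of the fibres; the other uses in addition that [theta]
restricted to [I] is a map, so that a single value of [g] already is a value
of [theta(f)].  Consequently [g] restricted to [I] depends on [f*] only,
whichever [f] inducing [f*] is taken: this makes the restriction of [theta*]
a map, makes [f*] single-valued because [g] is, and gives the morphism
condition for [theta*].

What remains is that the quotient is a space.  It is generated by itself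
through the identity, and it is closed under every [f*] because [S] is closed
under every [f] in [T] ([generated_closed]): that is where the composition
axiom of a par-operator gen-semigroup enters. *)

(** * Predicates holding along a sequence *)

Section ForallSeq.
Variables (X Y : Type).

Lemma Forall_map (A : set X) (B : set Y) (h : X -> Y) xs :
  (forall x, A x -> B (h x)) -> List.Forall A xs -> List.Forall B (map h xs).
Proof.
by move=> AB; elim=> [|x s Ax _ IH] /=; constructor => //; exact: AB.
Qed.

Lemma Forall_imageP (A : set X) (h : X -> Y) ys :
  List.Forall (h @` A) ys -> exists2 xs, List.Forall A xs & ys = map h xs.
Proof.
elim=> [|y s [x Ax <-] _ [xs Axs ->]]; first by exists [::].
by exists (x :: xs) => //; constructor.
Qed.

Lemma Forall_nth (A : set X) x0 xs i :
  List.Forall A xs -> i < size xs -> A (nth x0 xs i).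
Proof. by move=> Axs; elim: Axs i => [|x s Ax _ IH] [|i] //= /IH. Qed.

Lemma Forall_flatten (I : Type) (A : set X) (F : I -> seq X) s :
  (forall i, List.Forall A (F i)) -> List.Forall A (flatten (map F s)).
Proof.
move=> AF; elim: s => [|i s IH] /=; first by constructor.
by apply/List.Forall_app; split.
Qed.

End ForallSeq.

(** * Spaces are closed under the operators *)

(** Substituting the expressions of the arguments over [U] into [f] gives a
composite, of which some element of [T] is an extension. *)
Lemma generated_closed (X : Type) (D : set X) (T : set (graph X)) (U : set X)
    f xs y :
  par_operator_gen_semigroup D T -> T f ->
  List.Forall (generated T U) xs -> f (xs, y) -> generated T U y.
Proof.
move=> [Top Tcomp] Tf Sxs fxy.
have [n n_gt0 fn] := Top _ Tf.
have [szxs _ _] := fn.1 _ _ fxy.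
pose ys (i : 'I_n) := nth y xs i.
have /choice [gu guP] : forall i, exists p : graph X * seq X,
    [/\ T p.1, 0 < size p.2, List.Forall U p.2 & p.1 (p.2, ys i)].
  move=> i; have [|g [us gus]] := Forall_nth y (i := i) Sxs.
    by rewrite szxs.
  by exists (g, us).
have [|h Th hP] := Tcomp n f (fun i => (gu i).1) n_gt0 Tf fn.
  by move=> i; have [] := guP i.
exists h, (flatten [seq (gu i).2 | i : 'I_n]); split => //.
(* [f] has at least one argument, whose expression is nonempty. *)
- rewrite size_flatten sumnE /shape big_map /image_mem big_map big_enum /=.
  rewrite (bigD1 (Ordinal n_gt0)) //= addn_gt0.
  by have [_ -> _ _] := guP (Ordinal n_gt0).
- by apply: Forall_flatten => i; have [] := guP i.
- apply: hP; exists (fun i => (gu i).2), ys; split => //=.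
    by move=> i; have [] := guP i.
  (* The enumeration of ['I_n] lists the indices of [xs] in order. *)
  have -> // : [seq ys i | i : 'I_n] = xs.
  rewrite /image_mem enumT -enumT (map_comp (nth y xs) val) val_enum_ord -szxs.
  exact: mkseq_nth.
Qed.

Lemma space_closed (X : Type) (D : set X) (T : set (graph X)) (S : set X)
    f xs y :
  par_operator_gen_semigroup D T -> is_space D T S -> T f ->
  List.Forall S xs -> f (xs, y) -> S y.
Proof. by move=> hT [U _ ->]; exact: (generated_closed hT). Qed.

(** * The quotient by the fibres *)

Section Fibres.
Variables (X : Type) (X' : pointedType) (S : set X) (phi : X -> X').

(** The point [x] lies in both fibres, so [z] need not be assumed to be in the
image. *)
Lemma fibre_phi_inj x z : S x -> fibre S phi z = fibre S phi (phi x) -> z = phi x.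
Proof.
move=> Sx e; have : fibre S phi (phi x) x by [].
by rewrite -e => -[].
Qed.

Lemma map_fibre_phi_inj xs zs : List.Forall S xs ->
  map (fibre S phi) zs = map (fun x => fibre S phi (phi x)) xs ->
  zs = map phi xs.
Proof.
move=> Sxs; elim: Sxs zs => [|x s Sx _ IH] [|z zs] //= [e es].
by rewrite (fibre_phi_inj Sx e) (IH _ es).
Qed.

Lemma phi_star_fibre z : (phi @` S) z -> phi_star S phi (fibre S phi z) = z.
Proof.
move=> Iz; rewrite /phi_star.
have /getPex [[x Sx <-] e] : exists w, (phi @` S) w /\ fibre S phi w = fibre S phi z.
  by exists z.
by apply/esym/fibre_phi_inj.
Qed.

Lemma map_phi_star_fibre zs : List.Forall (phi @` S) zs ->
  map (phi_star S phi) (map (fibre S phi) zs) = zs.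
Proof. by elim=> //= z s Iz _ ->; rewrite phi_star_fibre. Qed.

Lemma phi_star_bij : set_bij (quotient S phi) (phi @` S) (phi_star S phi).
Proof.
split=> [_ [z Iz <-]|q q' + + |z Iz].
- by rewrite phi_star_fibre.
- by rewrite !inE => -[z Iz <-] [z' Iz' <-]; rewrite !phi_star_fibre // => ->.
- by exists (fibre S phi z); [exists z|rewrite phi_star_fibre].
Qed.

(** Being a map after restriction is a condition on the image of the morphism,
which for [phi_star] is thus that of [phi]. *)
Lemma phi_star_image : phi_star S phi @` quotient S phi = phi @` S.
Proof.
have [fun_star _ surj_star] := phi_star_bij.
by apply/seteqP; split=> [_ [q Qq <-]|z /surj_star]; first exact: fun_star.
Qed.

Lemma quotient_phi x : S x -> quotient S phi (fibre S phi (phi x)).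
Proof. by move=> Sx; exists (phi x) => //; exists x. Qed.

Lemma graph_star_quotient f (qs : seq (set X)) q :
  (forall xs y, List.Forall S xs -> f (xs, y) -> S y) ->
  graph_star S phi f (qs, q) -> quotient S phi q.
Proof.
move=> fS [xs [y [Sxs fxy [_ ->]]]]; apply: quotient_phi; exact: fS fxy.
Qed.

(** The identity generates every point; the starred operators stay inside. *)
Lemma quotient_space (D : set X) (T : set (graph X)) :
  par_operator_gen_semigroup D T -> is_space D T S ->
  is_space (quotient S phi) (T_sharp S phi T) (quotient S phi).
Proof.
move=> hT hS; exists (quotient S phi) => //; apply/seteqP; split=> q.
- move=> Qq; exists (id_graph (quotient S phi)), [:: q].
  by split=> //; [left|constructor|exists q].
- move=> [F [qs [[->|[f Tf <-]] _ _]]]; first by move=> [r Qr [_ <-]].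
  apply: graph_star_quotient => xs y; exact: space_closed hT hS Tf.
Qed.

End Fibres.

(** * Starred operators of a morphism *)

Section Morphism.
Variables (X : Type) (X' : pointedType) (D : set X) (D' : set X').
Variables (T : set (graph X)) (T' : set (graph X')).
Variables (theta : set (graph X * graph X')).
Variables (S : set X) (S' : set X') (phi : X -> X').
Hypothesis hT : par_operator_gen_semigroup D T.
Hypothesis hphi : theta_morphism D T D' T' theta S S' phi.

Let f_star := graph_star S phi.
Let I := phi @` S.

(** All partners of [f] agree on the image, so the value of one of them is a
value of [theta(f)]. *)
Lemma theta_app_of_image f g zs z :
  theta (f, g) -> List.Forall I zs -> g (zs, z) -> theta_app theta f (zs, z).
Proof.
case: hphi => _ _ _ hmap _ fg Izs gz; split; first by exists g.
move=> g' fg'.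
have e : restrict_vars I g = restrict_vars I g'.
  by apply: (hmap f); [exists (f, g)|exists (f, g')].
have : restrict_vars I g (zs, z) by [].
by rewrite e => -[].
Qed.

(** From left to right, the starred graph only supplies some representatives of
the fibres; the morphism property at these representatives gives the value of
[g], which depends on their images alone.  From right to left, any
representatives of [zs] will do, because a value of [theta(f)] forces [f] to be
defined at them. *)
Lemma graph_star_fibre f g zs z : theta (f, g) -> List.Forall I zs ->
  f_star f (map (fibre S phi) zs, fibre S phi z) <-> g (zs, z).
Proof.
move=> fg Izs; case: hphi => hop _ _ _ hval.
have [_ _ [n n_gt0 fn] [m m_gt0 gm]] := hop _ _ fg.
have fdom : dom_theta theta f by exists g.
split.
- move=> [xs [y [Sxs fxy [ezs ez]]]].
  have [szxs Dxs Dy] := fn.1 _ _ fxy.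
  have xs_gt0 : 0 < size xs by rewrite szxs.
  rewrite (map_fibre_phi_inj Sxs ezs).
  case: (hval xs f xs_gt0 Sxs fdom) => [[nf _]|]; first by case: nf; exists y.
  move=> [y' [w [fxy' [_ /(_ _ fg) gw] yw]]].
  have yy' : y' = y by exact: fn.2 fxy' fxy.
  have Sy : S y.
    case: hphi => _ [hS _] _ _ _.
    by have [Tf _ _ _] := hop _ _ fg; exact: space_closed hT hS Tf Sxs fxy.
  by rewrite (fibre_phi_inj Sy ez) -yy' yw.
- move=> gz; have [szzs _ _] := gm.1 _ _ gz.
  have app := theta_app_of_image fg Izs gz.
  have [xs Sxs ezs] := Forall_imageP Izs.
  rewrite ezs size_map in szzs; rewrite ezs in app gz *.
  have xs_gt0 : 0 < size xs by rewrite szzs.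
  case: (hval xs f xs_gt0 Sxs fdom) => [[_ nt]|]; first by case: nt; exists z.
  move=> [y [w [fxy [_ /(_ _ fg) gw] yw]]].
  exists xs, y; split=> //; congr (_, fibre S phi _).
    by rewrite -map_comp.
  by rewrite yw; exact: gm.2 gz gw.
Qed.

(** The right-hand side does not mention [f]: two operators with the same
starred graph have partners with the same values on the image. *)
Lemma theta_star_app f g zs z : theta (f, g) -> List.Forall I zs ->
  theta_app (theta_star S phi theta) (f_star f) (zs, z) <-> g (zs, z).
Proof.
move=> fg Izs; split=> [[_]|gz]; first by apply; exists (f, g).
split=> [|_ [[f' g'] fg' [e <-]]]; first by exists g, (f, g).
apply/(graph_star_fibre z fg' Izs); rewrite /f_star e.
exact/(graph_star_fibre z fg Izs).
Qed.

(** Arity and stability come from [f], single-valuedness from [g]. *)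
Lemma graph_star_operator f g :
  theta (f, g) -> operator (quotient S phi) (f_star f).
Proof.
move=> fg; case: hphi => hop [hS _] _ _ _.
have [Tf _ [n n_gt0 fn] [m _ gm]] := hop _ _ fg.
have fS xs y : List.Forall S xs -> f (xs, y) -> S y.
  exact: space_closed hT hS Tf.
exists n => //; split=> [qs q fq|qs q q' fq fq'].
- split; [|case: fq => xs [y [Sxs _ [-> _]]]|exact: graph_star_quotient fq].
    case: fq => xs [y [_ /fn.1 [szxs _ _] [-> _]]]; by rewrite size_map.
  by apply: Forall_map Sxs => x; exact: quotient_phi.
- case: (fq) => xs [y [Sxs _ [eqs _]]].
  have [z _ ez] := graph_star_quotient fS fq.
  have [z' _ ez'] := graph_star_quotient fS fq'.
  have Izs : List.Forall I (map phi xs).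
    by apply: Forall_map Sxs => x Sx; exists x.
  rewrite -ez -ez' eqs (map_comp (fibre S phi) phi) in fq fq' *.
  move/(graph_star_fibre _ fg Izs): fq => gz.
  move/(graph_star_fibre _ fg Izs): fq' => gz'.
  by rewrite (gm.2 _ _ _ gz gz').
Qed.

Lemma theta_star_operator_relation :
  operator_relation (quotient S phi) (T_sharp S phi T) D' T'
    (theta_star S phi theta).
Proof.
move=> _ _ [[f g] fg [<- <-]]; case: hphi => hop _ _ _ _.
have [Tf T'g _ opg] := hop _ _ fg.
by split=> //; [right; exists f|exact: graph_star_operator fg].
Qed.

Lemma theta_star_restr_is_map : is_map (theta_restr (theta_star S phi theta) I).
Proof.
move=> F _ _ [_ [[f g] fg <-] [<- <-]] [_ [[f' g'] fg' <-] [/= e <-]].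
apply/seteqP; split=> -[zs z] /= [gz Izs]; split=> //.
- by apply/(theta_star_app z fg' Izs); rewrite /f_star e; apply/(theta_star_app z fg Izs).
- by apply/(theta_star_app z fg Izs); rewrite /f_star -e; apply/(theta_star_app z fg' Izs).
Qed.

(** Both sides of the condition are translated into the single statement that
[g] has a value at the points over which the fibres [qs] lie. *)
Lemma theta_star_values qs F : List.Forall (quotient S phi) qs ->
  dom_theta (theta_star S phi theta) F ->
  let app z := theta_app (theta_star S phi theta) F
                 (map (phi_star S phi) qs, z) in
  (~ (exists q, F (qs, q)) /\ ~ (exists z, app z)) \/
  (exists q z, [/\ F (qs, q), app z & phi_star S phi q = z]).
Proof.
move=> Qqs [_ [[f g] fg [<- _]]] /=.
have [zs Izs ->] := Forall_imageP Qqs; rewrite map_phi_star_fibre //.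
case: (pselect (exists q, f_star f (map (fibre S phi) zs, q))) => [[q fq]|nf].
- have [z Iz ez] : quotient S phi q.
    apply: graph_star_quotient fq => xs y.
    case: hphi => hop [hS _] _ _ _; have [Tf _ _ _] := hop _ _ fg.
    exact: space_closed hT hS Tf.
  right; exists q, z; split=> //; last by rewrite -ez phi_star_fibre.
  by apply/(theta_star_app z fg Izs)/(graph_star_fibre z fg Izs); rewrite ez.
- left; split=> // -[z] /(theta_star_app z fg Izs) gz; apply: nf.
  by exists (fibre S phi z); apply/(graph_star_fibre z fg Izs).
Qed.

End Morphism.

(** * The induced isomorphism *)

Theorem theorem22p2p4 (X : Type) (X' : pointedType)
    (D : set X) (D' : set X') (T : set (graph X)) (T' : set (graph X'))
    (theta : set (graph X * graph X'))
    (S : set X) (S' : set X') (phi : X -> X')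
    (hT : par_operator_gen_semigroup D T)
    (hT' : par_operator_gen_semigroup D' T')
    (hphi : theta_morphism D T D' T' theta S S' phi)
    (hIm : is_space D' T' (phi @` S)) :
  theta_isomorphism (quotient S phi) (T_sharp S phi T) D' T'
    (theta_star S phi theta) (quotient S phi) (phi @` S) (phi_star S phi).
Proof.
have bij := phi_star_bij S phi.
split=> //; split.
- exact: theta_star_operator_relation hT hphi.
- split=> //; case: hphi => _ [hS _] _ _ _; exact: quotient_space hT hS.
- by case: bij.
- by rewrite phi_star_image; exact: theta_star_restr_is_map hT hphi.
- by move=> qs F _; exact: (theta_star_values hT hphi).
Qed.
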